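(* Let $N\ge 1$ be an integer and let $Q_N$ and $P_N$ be the $(N+1)\times(N+1)$ position and momentum matrices. The eigenvalues of $Q_N$ and of $P_N$ are identical and are given by the zeros of the Hermite polynomial $H_{N+1}$. Consequently $Q_N$ and $P_N$ are unitarily equivalent: there exists a unitary matrix $F_N\in\mathbb{C}^{(N+1)\times(N+1)}$ such that $P_N=F_N^\dagger Q_N F_N$.
   Context: Rows and columns are indexed by $0,1,\dots,N$. The position matrix $Q_N$ is the real symmetric tridiagonal matrix with $(Q_N)_{k,k+1}=(Q_N)_{k+1,k}=\sqrt{k+1}/\sqrt{2}$ for $k=0,\dots,N-1$ and all other entries $0$. The momentum matrix $P_N$ is the Hermitian tridiagonal matrix with $(P_N)_{k,k+1}=-i\sqrt{k+1}/\sqrt{2}$ and $(P_N)_{k+1,k}=i\sqrt{k+1}/\sqrt{2}$ for $k=0,\dots,N-1$ and all other entries $0$. The Hermite polynomials are the classical ones, given by $H_0(\lambda)=1$, $H_1(\lambda)=2\lambda$ and $H_{k+1}(\lambda)=2\lambda H_k(\lambda)-2kH_{k-1}(\lambda)$ for $k\ge 1$. $\dagger$ denotes the conjugate transpose. *)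

(* Defs.v *)
From HB Require Import structures.
From mathcomp Require Import all_boot all_order all_algebra.
From mathcomp Require Import reals.
From mathcomp Require Import complex.

Set Implicit Arguments.
Unset Strict Implicit.
Unset Printing Implicit Defensive.

Import Order.TTheory GRing.Theory Num.Theory.
Local Open Scope ring_scope.

(* [sqrtC] is the nonnegative square root at these nonnegative real arguments.
   The arguments [k.+1] and [j.+1] are the larger of the two adjacent indices. *)
Definition position_mx (C : numClosedFieldType) (N : nat) : 'M[C]_N.+1 :=
  \matrix_(k < N.+1, j < N.+1)
    if j == k.+1 :> nat then sqrtC k.+1%:R / sqrtC 2%:R
    else if k == j.+1 :> nat then sqrtC j.+1%:R / sqrtC 2%:R
    else 0.

Definition momentum_mx (C : numClosedFieldType) (N : nat) : 'M[C]_N.+1 :=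
  \matrix_(k < N.+1, j < N.+1)
    if j == k.+1 :> nat then - 'i * (sqrtC k.+1%:R / sqrtC 2%:R)
    else if k == j.+1 :> nat then 'i * (sqrtC j.+1%:R / sqrtC 2%:R)
    else 0.

(* The last branch is the recurrence at index [k'.+1]:
   H_(k' + 2) = 2 X H_(k' + 1) - 2 (k' + 1) H_(k'). *)
Fixpoint hermite (R : comNzRingType) (n : nat) : {poly R} :=
  match n with
  | 0%N => 1
  | n'.+1 =>
    match n' with
    | 0%N => 2%:R *: 'X
    | k'.+1 => 2%:R *: 'X * hermite R n' - (2 * k'.+1)%:R *: hermite R k'
    end
  end.

(* Main.v *)
Require Import Defs.
From HB Require Import structures.
From mathcomp Require Import all_boot all_order all_algebra.
From mathcomp Require Import reals.
From mathcomp Require Import complex.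
From mathcomp Require Import ring.

Set Implicit Arguments.
Unset Strict Implicit.
Unset Printing Implicit Defensive.

Import Order.TTheory GRing.Theory Num.Theory.
Local Open Scope ring_scope.
Local Open Scope sesquilinear_scope.

(** An eigenvector of [Q_N] for [a] is, up to a scalar, the vector of the
    orthonormal Hermite functions [h_n a = H_n a / sqrt (2 ^ n n!)] for [n <= N]:
    columns [0, ..., N - 1] of the eigenvalue equation are their three-term
    recurrence, and the last column says that [h_(N + 1) a] vanishes.
    Conjugation by the diagonal unitary matrix with entries [(- 'i) ^+ k] turns
    [Q_N] into [P_N]. *)

Section Hermite.

Variable C : numClosedFieldType.
Implicit Types (a : C) (w : nat -> C).

Definition position_coef (k : nat) : C := sqrtC k.+1%:R / sqrtC 2%:R.

Lemma position_coef_neq0 k : position_coef k != 0.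
Proof. by rewrite mulf_neq0 ?invr_neq0 ?sqrtC_eq0 ?pnatr_eq0. Qed.

Lemma position_coef_sqr k : position_coef k ^+ 2 = k.+1%:R / 2%:R.
Proof. by rewrite exprMn exprVn !sqrtCK. Qed.

(** Column [n] of the row vector [w] times the infinite Jacobi matrix that [position_mx] truncates.
    Sequences over [nat] let the recurrence run one index past the matrix. *)
Definition jacobi_op w (n : nat) : C :=
  (if n is m.+1 then w m * position_coef m else 0) + w n.+1 * position_coef n.

(* [2 ^ n] times the product of the coefficients is [sqrt (2 ^ n n!)]. *)
Definition hermite_fun a (n : nat) : C :=
  (hermite C n).[a] / (2%:R ^+ n * \prod_(i < n) position_coef i).

Lemma hermite_fun0 a : hermite_fun a 0 = 1.
Proof. by rewrite /hermite_fun big_ord0 expr0 mulr1 divr1 hornerC. Qed.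

Lemma hermite_fun_eq0 a n : (hermite_fun a n == 0) = root (hermite C n) a.
Proof.
rewrite /root mulf_eq0 invr_eq0 mulf_eq0 expf_eq0 pnatr_eq0 andbF /=.
have /negPf-> : \prod_(i < n) position_coef i != 0.
  by apply/prodf_neq0 => i _; apply: position_coef_neq0.
by rewrite orbF.
Qed.

Lemma hermiteSS_horner a n :
  (hermite C n.+2).[a] =
  2%:R * a * (hermite C n.+1).[a] - (2 * n.+1)%:R * (hermite C n).[a].
Proof.
rewrite -[hermite C n.+2]/(2%:R *: 'X * hermite C n.+1
  - (2 * n.+1)%:R *: hermite C n).
by rewrite hornerD hornerN hornerM !hornerZ hornerX.
Qed.

Lemma hermite_fun_jacobi a n : jacobi_op (hermite_fun a) n = a * hermite_fun a n.
Proof.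
have c_neq0 := position_coef_neq0.
have two_neq0 : 2%:R != 0 :> C by rewrite pnatr_eq0.
rewrite /jacobi_op /hermite_fun; case: n => [|n].
  rewrite big_ord_recr !big_ord0 /= hornerZ hornerX hornerC.
  by field; rewrite c_neq0.
rewrite hermiteSS_horner !big_ord_recr /=.
set p := \prod_(i < n) _.
have p_neq0 : p != 0 by apply/prodf_neq0 => i _; apply: c_neq0.
have := position_coef_sqr n.
move: (c_neq0 n) (c_neq0 n.+1).
move: (position_coef n) (position_coef n.+1) => c d c0 d0 cE.
(* With [n.+1] written as [2 * c ^+ 2] no square root remains, and the goal is an identity of
   rational functions in [c], [d], [e] and [p]. *)
have sE : n.+1%:R = 2%:R * c ^+ 2 :> C by rewrite cE mulrC divfK.
rewrite natrM sE !exprS.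
have : 2%:R ^+ n != 0 :> C by rewrite expf_neq0.
move: (2%:R ^+ n) => e e0.
by field; rewrite c0 d0 p_neq0 e0.
Qed.

(** As [position_coef n] is nonzero, equation [n] determines [w n.+1] from the two values before it,
    so [w 0] fixes everything. Equations [0] to [N] reach index [N.+1]. *)
Lemma jacobi_eigen_hermite a w N :
  (forall n, (n < N.+1)%N -> jacobi_op w n = a * w n) ->
  forall n, (n <= N.+1)%N -> w n = w 0%N * hermite_fun a n.
Proof.
move=> wE n; have [m] := ubnP n; elim: m n => // m IHm [|n] lt_nm le_nN.
  by rewrite hermite_fun0 mulr1.
have eqn := wE n le_nN; have eqh := hermite_fun_jacobi a n.
apply: (mulIf (position_coef_neq0 n)).
have wn : w n = w 0%N * hermite_fun a n by apply: IHm; rewrite // ltnW.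
move: eqn eqh; rewrite /jacobi_op wn.
case: n lt_nm le_nN {wn} => [|n] lt_nm le_nN.
  by rewrite !add0r => -> eqh; rewrite -mulrA eqh; ring.
have -> : w n = w 0%N * hermite_fun a n.
  by apply: IHm; [rewrite ltnW | rewrite ltnW // ltnW].
move=> eqn eqh; apply: (addrI (w 0%N * hermite_fun a n * position_coef n)).
by rewrite eqn -2!(mulrA (w 0%N)) -mulrDr eqh mulrCA.
Qed.

(** Truncation only drops the term [w N.+1 * position_coef N] from the last column, and the
    hypothesis makes it zero. *)
Lemma row_mul_position N w : w N.+1 = 0 ->
  (\row_(k < N.+1) w k) *m position_mx C N = \row_(j < N.+1) jacobi_op w j.
Proof.
move=> wN; apply/rowP => j; rewrite !mxE /jacobi_op.
under eq_bigr => k _ do rewrite !mxE.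
(* The two off-diagonals are disjoint, so the nested tests split into a sum of two terms, each
   supported on at most one [k]. *)
rewrite (eq_bigr (fun k : 'I_N.+1 =>
    (if j == k.+1 :> nat then w k * position_coef k else 0)
    + (if k == j.+1 :> nat then w k * position_coef j else 0))); last first.
  move=> k _; case: (altP (nat_of_ord j =P k.+1)) => [->|_].
    by rewrite ifF ?addr0 // ltn_eqF // ltnW.
  by rewrite add0r; case: eqP => // _; rewrite mulr0.
rewrite big_split /= -!big_mkcond /=; congr (_ + _).
  case: j => [[|j] ltj] /=; first by rewrite big_pred0_eq.
  by rewrite (big_pred1 (Ordinal (ltnW ltj))) // => k; rewrite eqSS eq_sym.
have [lt_jN|le_Nj] := ltnP j.+1 N.+1.
  by rewrite (big_pred1 (Ordinal lt_jN)).
have jE : j.+1 = N.+1 by apply/eqP; rewrite eqn_leq le_Nj ltn_ord.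
by rewrite jE wN mul0r big_pred0 // => k; rewrite ltn_eqF.
Qed.

Lemma eigenvalue_position N a :
  eigenvalue (position_mx C N) a <-> root (hermite C N.+1) a.
Proof.
split=> [/eigenvalueP[v vE v_neq0] | ].
  (* Extending [v] by zero supplies the boundary value [w N.+1 = 0]. *)
  pose w n := if insub n is Some k then v 0 k else 0 : C.
  have wE k : w (nat_of_ord k) = v 0 k by rewrite /w valK.
  have wN : w N.+1 = 0 by rewrite /w insubF ?ltnn.
  have vrow : v = \row_(k < N.+1) w k by apply/rowP => k; rewrite mxE wE.
  have w_jacobi n : (n < N.+1)%N -> jacobi_op w n = a * w n.
    move=> lt_nN; have := row_mul_position wN; rewrite -vrow vE.
    by move=> /rowP/(_ (Ordinal lt_nN)); rewrite !mxE -wE => ->.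
  have w_herm := jacobi_eigen_hermite w_jacobi.
  rewrite -hermite_fun_eq0; have /eqP := w_herm _ (leqnn N.+1).
  (* If [w 0] vanished, so would every entry of [v]; hence the other factor is zero. *)
  rewrite wN eq_sym mulf_eq0 => /orP[/eqP w0|//].
  case/eqP: v_neq0; apply/rowP => k.
  by rewrite -wE w_herm ?w0 ?mul0r ?mxE // ltnW.
rewrite -hermite_fun_eq0 => /eqP hN.
apply/eigenvalueP; exists (\row_(k < N.+1) hermite_fun a k).
  rewrite row_mul_position //.
  by apply/rowP => j; rewrite !mxE hermite_fun_jacobi.
apply/eqP => /rowP/(_ 0); rewrite !mxE hermite_fun0.
by apply/eqP; rewrite oner_eq0.
Qed.

Definition phase_mx N : 'M[C]_N.+1 := diag_mx (\row_k (- 'i) ^+ k).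

Lemma conj_phase (k : nat) : ((- 'i) ^+ k)^* = 'i ^+ k :> C.
Proof. by rewrite rmorphXn rmorphN /= conjCi opprK. Qed.

Lemma mul_phase (k : nat) : 'i ^+ k * (- 'i) ^+ k = 1 :> C.
Proof. by rewrite -exprMn mulrN -expr2 sqrCi opprK expr1n. Qed.

Lemma adj_phase_mx N : (phase_mx N)^t* = diag_mx (\row_k 'i ^+ k).
Proof.
rewrite /phase_mx tr_diag_mx map_diag_mx; congr diag_mx.
by apply/rowP => k; rewrite !mxE; apply: conj_phase.
Qed.

Lemma phase_mx_unitary N : phase_mx N \is unitarymx.
Proof.
apply/unitarymxP; rewrite adj_phase_mx mulmx_diag; apply/matrixP => i j.
by rewrite !mxE mulrC mul_phase.
Qed.

(** Entry [(k, j)] gets the factor ['i ^+ k * (- 'i) ^+ j], which is [- 'i] for [j = k.+1] and ['i]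
    for [k = j.+1]. *)
Lemma momentum_conj_position N :
  momentum_mx C N = (phase_mx N)^t* *m position_mx C N *m phase_mx N.
Proof.
rewrite adj_phase_mx -mulmxA mul_diag_mx mul_mx_diag; apply/matrixP => k j.
rewrite !mxE; case: eqP => [->|_].
  by rewrite exprS -[LHS]mulr1 -(mul_phase k); ring.
case: eqP => [->|_]; last by rewrite mul0r mulr0.
by rewrite exprS -[LHS]mulr1 -(mul_phase j); ring.
Qed.

(** Row eigenvectors are carried across by right multiplication with [F^t*] one way and [F] the
    other. *)
Lemma eigenvalue_unitary_conj n (A F : 'M[C]_n) a : F \is unitarymx ->
  eigenvalue (F^t* *m A *m F) a = eigenvalue A a.
Proof.
move=> uF; have uFt : F^t* \is unitarymx by rewrite trmxC_unitary.
have FK : F *m F^t* = 1%:M by apply/unitarymxP.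
have FtK : F^t* *m F = 1%:M by apply: mulmx1C.
apply/eigenvalueP/eigenvalueP => -[v vE v_neq0].
  exists (v *m F^t*).
    by rewrite scalemxAl -vE !mulmxA -[RHS]mulmxA FK mulmx1.
  apply: contra v_neq0 => /eqP vF.
  by rewrite -[v]mulmx1 -FtK mulmxA vF mul0mx.
exists (v *m F).
  by rewrite scalemxAl -vE !mulmxA -(mulmxA v) FK mulmx1.
apply: contra v_neq0 => /eqP vF.
by rewrite -[v]mulmx1 -FK mulmxA vF mul0mx.
Qed.

End Hermite.

Theorem mainTheorem3 (R : realType) (N : nat) (hN : (1 <= N)%N) :
  [/\ forall a : R[i], eigenvalue (position_mx R[i] N) a <-> root (hermite R[i] N.+1) a,
      forall a : R[i], eigenvalue (momentum_mx R[i] N) a <-> root (hermite R[i] N.+1) a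
    & exists2 F : 'M[R[i]]_N.+1, F \is unitarymx
        & momentum_mx R[i] N = F ^t* *m position_mx R[i] N *m F].
Proof.
have uF := phase_mx_unitary R[i] N.
have PE := momentum_conj_position R[i] N.
split; [exact: eigenvalue_position | | by exists (phase_mx R[i] N)].
by move=> a; rewrite PE eigenvalue_unitary_conj //; apply: eigenvalue_position.
Qed.
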